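(* Let $\Lambda$ be a discrete group with a proper integer-valued length function $L$, and let $C_n=\{\gamma\in\Lambda : L(\gamma)\in[n,n+1)\}$ for $n\in\mathbb{N}$. Let $(B,\nu)$ be a probability space equipped with a measurable action $\Lambda\curvearrowright B$ leaving $\nu$ quasi-invariant. Let $\pi:\Lambda\to\mathcal{U}(L^2(B,\nu))$ be the associated Koopman representation and $\Xi$ the associated Harish-Chandra function. Assume that there are $M\in\mathbb{R}$ and a real polynomial $P\in\mathbb{R}[X]$ such that, for every $n\in\mathbb{N}$ with $C_n\neq\emptyset$, (1) $\displaystyle \sup_{\gamma\in C_n}\Xi(\gamma)\le \frac{P(n)}{\sqrt{|C_n|}}$; (2) $\displaystyle \left\Vert \frac{1}{|C_n|}\sum_{\gamma\in C_n}\frac{\pi(\gamma)}{\Xi(\gamma)}\right\Vert_{2\to2}\le M$. Then $\Lambda$ has the radial rapid decay property (RRD) with respect to $L$.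
   Context: A length function on a group $\Lambda$ with identity $e$ is a map $L:\Lambda\to\mathbb{R}_+$ with $L(e)=0$, $L(g^{-1})=L(g)$ and $L(gh)\le L(g)+L(h)$ for all $g,h$. On a discrete group it is proper if $\{g: L(g)\le t\}$ is finite for every $t\ge 0$. $\mathbb{C}[\Lambda]$ is the space of finitely supported functions on $\Lambda$. A function $f\in\mathbb{C}[\Lambda]$ is radial (with respect to $L$) if $L(g_1)=L(g_2)$ implies $f(g_1)=f(g_2)$. For $f\in\mathbb{C}[\Lambda]$ nonzero, $L(f):=\max\{L(g): g\in\operatorname{supp}(f)\}$; $\Vert f\Vert_{op}$ is the operator norm of $\xi\mapsto f*\xi$ on $\ell^2(\Lambda)$, where $(f*\xi)(g)=\sum_{h}f(h)\xi(h^{-1}g)$; $\Vert f\Vert_2$ is the $\ell^2$-norm. $\Lambda$ has RRD with respect to $L$ if there is $P\in\mathbb{R}[X]$ such that $\Vert f\Vert_{op}\le P(L(f))\Vert f\Vert_2$ for every (nonzero) radial $f\in\mathbb{C}[\Lambda]$. The measure $\nu$ is quasi-invariant if $\nu(C)=0$ implies $\nu(gC)=0$ for all group elements $g$ and measurable $C$. The Radon-Nikodym cocycle is $c(g,b)=\frac{d (g^{-1})_*\nu}{d\nu}(b)>0$. The Koopman representation is the unitary representation $(\pi(g)h)(b)=c(g^{-1},b)^{1/2}h(g^{-1}b)$ on $L^2(B,\nu)$. The Harish-Chandra function is $\Xi(g)=\int_B c(g^{-1},b)^{1/2}\,d\nu(b)=\langle\pi(g)\mathbf{1}_B,\mathbf{1}_B\rangle$.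 $\Vert\cdot\Vert_{2\to2}$ is the operator norm on $L^2(B,\nu)$. *)

(* Defs.v *)
From HB Require Import structures.
From mathcomp Require Import all_boot all_order all_algebra.
From mathcomp Require Import finmap.
From mathcomp Require Import all_classical all_reals all_analysis.
From mathcomp Require Import complex.

Set Implicit Arguments.
Unset Strict Implicit.
Unset Printing Implicit Defensive.

Import Order.TTheory GRing.Theory Num.Theory.
Import numFieldNormedType.Exports.

Local Open Scope classical_set_scope.
Local Open Scope ring_scope.
Local Open Scope complex_scope.

(* The complex modulus as an element of R (the norm `|z| lives in R[i]). *)
Notation modulus := ComplexField.Normc.normc.

Section LengthFunctions.
Context (R : realType) (Lam : groupType).
Implicit Type L : Lam -> R.

Definition length_function L :=
  [/\ forall g, 0 <= L g, L 1%g = 0, forall g, L g^-1%g = L g &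
      forall g h, L (g * h)%g <= L g + L h].

Definition proper_length L :=
  forall t : R, 0 <= t -> finite_set [set g | L g <= t].

Definition annulus L (n : nat) : set Lam := [set g | n%:R <= L g < n.+1%:R].

(* [fset_set] is meaningful only on finite sets; annuli of a proper length
   function are finite. *)
Definition card_annulus L (n : nat) : nat := #|` fset_set (annulus L n)|.

End LengthFunctions.

Definition op_norm (R : realType) (V : Type) (D : set V) (N : V -> \bar R)
    (A : V -> V) : \bar R :=
  ereal_sup [set N (A v) | v in [set v | D v /\ (N v <= 1)%E]].

Section RapidDecay.
Context (R : realType) (Lam : groupType).

(* Finitely supported complex functions; [finsupp f] is the support of f. *)
Definition group_algebra := {fsfun Lam -> R[i] with 0}.

Definition radial (L : Lam -> R) (f : group_algebra) :=
  forall g1 g2, L g1 = L g2 -> f g1 = f g2.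

(* L(f). The starting value 0 does not change the maximum, because L is
   nonnegative and L(f) is only used for f <> 0. *)
Definition length_of (L : Lam -> R) (f : group_algebra) : R :=
  \big[Num.max/0]_(g <- finsupp f) L g.

Definition convolution (f : group_algebra) (xi : Lam -> R[i]) : Lam -> R[i] :=
  fun g => \sum_(h <- finsupp f) f h * xi (h^-1 * g)%g.

Definition norm_ell2 (xi : Lam -> R[i]) : \bar R :=
  ((\esum_(g in [set: Lam]) (modulus (xi g) ^+ 2)%:E) `^ 2^-1)%E.

Definition ell2 : set (Lam -> R[i]) := [set xi | (norm_ell2 xi < +oo)%E].

Definition RRD (L : Lam -> R) :=
  exists P : {poly R}, forall f : group_algebra,
    finsupp f != fset0 -> radial L f ->
    (op_norm ell2 norm_ell2 (convolution f)
       <= (P.[length_of L f])%:E * norm_ell2 f)%E.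

End RapidDecay.

Section Koopman.
Context (d : measure_display) (B : measurableType d) (R : realType)
  (nu : probability B R) (Lam : groupType) (act : Lam -> {mfun B >-> B}).

Definition is_action :=
  (forall b, act 1%g b = b) /\
  (forall g h b, act (g * h)%g b = act g (act h b)).

Definition quasi_invariant :=
  forall g (C : set B), measurable C -> nu C = 0%E -> nu (act g @` C) = 0%E.

(* c(g, b) = d(g^-1)_* nu / d nu (b); [distribution nu X] is the pushforward
   X_* nu. This is one version of the derivative, positive almost everywhere
   when nu is quasi-invariant; everything below depends on it only up to
   nu-null sets. *)
Definition rn_cocycle (g : Lam) (b : B) : R :=
  fine (Radon_Nikodym
    (charge_of_finite_measure (distribution nu (act g^-1%g))) nu b).

(* L^2(B, nu) is represented by complex functions, not by their classes modulo
   almost everywhere equality; this does not affect operator norms. *)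
Definition norm_L2 (h : B -> R[i]) : \bar R :=
  'N[nu]_2%:E[(fun b => (modulus (h b))%:E)]%E.

Definition L2 : set (B -> R[i]) := [set h |
  [/\ measurable_fun [set: B] (fun b => complex.Re (h b)),
      measurable_fun [set: B] (fun b => complex.Im (h b))
    & (norm_L2 h < +oo)%E]].

Definition koopman (g : Lam) (h : B -> R[i]) : B -> R[i] :=
  fun b => (Num.sqrt (rn_cocycle g^-1%g b))%:C * h (act g^-1%g b).

Definition harish_chandra (g : Lam) : R :=
  \int[nu]_b Num.sqrt (rn_cocycle g^-1%g b).

Definition annulus_average (L : Lam -> R) (n : nat) (h : B -> R[i]) :
    B -> R[i] :=
  fun b => (card_annulus L n)%:R^-1 *
    \sum_(g \in annulus L n) koopman g h b / (harish_chandra g)%:C.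

End Koopman.

(* Main.v *)
Require Import Defs.
From mathcomp Require Import all_boot all_order all_algebra.
From mathcomp Require Import finmap.
From mathcomp Require Import all_classical all_reals all_analysis.
From mathcomp Require Import measurable_realfun.
From mathcomp Require Import complex ring lra.
Import Order.TTheory GRing.Theory Num.Theory.
Local Open Scope classical_set_scope.
Local Open Scope ring_scope.

(** Let lambda be the left regular representation, pi the Koopman
representation, and sigma_n the indicator function of the annulus C_n.

The heart of the matter is that pi dominates lambda on positive functions:
the norm of lambda(f) is at most that of pi(f) for every f >= 0. This is
obtained by combining two classical devices. Fell absorption: with 1 the
constant function on B, a vector xi of ell^2 is replaced by the family
g |-> xi(g) pi(g)1 of elements of L^2(B), and since pi(g)1 has norm 1 the
coefficients of lambda become coefficients of lambda (x) pi. Herz majorization: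
the vectors pi(g)1 are nonnegative functions, so the sum over g can be bounded
by Cauchy-Schwarz at each point b of B; this replaces the families by the single
functions Phi(b) = (sum_g |xi(g) (pi(g)1)(b)|^2)^(1/2) of L^2(B), which have the
same norm as xi, and leaves coefficients of pi alone ([herz_majorization]).

Dividing by Xi, bounded by P(n) / sqrt |C_n| on C_n, turns pi(sigma_n) into
|C_n| times an average of norm at most M, by hypothesis. Hence lambda(sigma_n) has
norm at most M P(n) sqrt |C_n|, that is, M P(n) times the ell^2 norm of sigma_n
([annulus_convolution_bound]).

Finally, L being integer-valued, a radial f is a combination of finitely many
sigma_n with n <= L(f), and each term a_n sigma_n has ell^2 norm at most that
of f. The norm of lambda(f) is therefore at most |M| times the sum of the
|P(n)| for n <= L(f), times the ell^2 norm of f; and this sum is bounded by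
the polynomial (X + 1) sum_i |p_i| X^i at X = L(f). *)

Set Implicit Arguments.
Unset Strict Implicit.
Unset Printing Implicit Defensive.

(** * Finite sums and complex moduli *)

Section FiniteSums.
Context (R : realType).

Lemma sum_subseq_le (I : eqType) (r1 r2 : seq I) (F : I -> R) :
  uniq r1 -> uniq r2 -> {subset r1 <= r2} -> (forall i, 0 <= F i) ->
  \sum_(i <- r1) F i <= \sum_(i <- r2) F i.
Proof.
move=> u1 u2 r12 F0.
have r1E : perm_eq r1 [seq i <- r2 | i \in r1].
  apply: uniq_perm => //; first exact: filter_uniq.
  move=> i; rewrite mem_filter; case: (boolP (i \in r1)) => //= /r12 ->//.
rewrite (perm_big _ r1E) big_filter big_mkcond.
by apply: ler_sum => i _; case: ifP.
Qed.

Lemma cauchy_schwarz_sum (I : Type) (r : seq I) (a b : I -> R) :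
  \sum_(i <- r) a i * b i <=
  Num.sqrt (\sum_(i <- r) a i ^+ 2) * Num.sqrt (\sum_(i <- r) b i ^+ 2).
Proof.
elim: r => [|i r IH]; first by rewrite !big_nil sqrtr0 mul0r.
rewrite !big_cons.
set A := \sum_(j <- r) a j ^+ 2 in IH *; set C := \sum_(j <- r) b j ^+ 2 in IH *.
have A0 : 0 <= A by apply: sumr_ge0 => j _; exact: sqr_ge0.
have C0 : 0 <= C by apply: sumr_ge0 => j _; exact: sqr_ge0.
apply: (le_trans (lerD (lexx _) IH)).
rewrite -[leRHS]sqrtrM ?addr_ge0 ?sqr_ge0//.
apply: le_trans (ler_norm _) _; rewrite -sqrtr_sqr ler_wsqrtr//.
rewrite -[in leRHS](sqr_sqrtr A0) -[in leRHS](sqr_sqrtr C0).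
(* the cross terms are controlled by the square of their difference *)
have := sqr_ge0 (a i * Num.sqrt C - b i * Num.sqrt A).
nra.
Qed.

Lemma modulus_ge0 (z : R[i]) : 0 <= modulus z.
Proof. by case: z => a b; exact: sqrtr_ge0. Qed.

Lemma modulus_sum_le (I : Type) (r : seq I) (F : I -> R[i]) :
  modulus (\sum_(i <- r) F i) <= \sum_(i <- r) modulus (F i).
Proof.
elim: r => [|i r IH]; first by rewrite !big_nil ComplexField.Normc.normc0.
rewrite !big_cons; apply: le_trans (le_normcD _ _) _.
by rewrite lerD2l.
Qed.

Lemma modulus_real (x : R) : 0 <= x -> modulus (x%:C)%C = x.
Proof. by move=> x0; rewrite /= expr0n addr0 sqrtr_sqr ger0_norm. Qed.

Lemma measurable_sqrtr : measurable_fun setT (@Num.sqrt R).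
Proof. by apply: continuous_measurable_fun; exact: sqrt_continuous. Qed.

End FiniteSums.

(** * The functions pi(g)1 *)

Section KoopmanWeight.
Context (d : measure_display) (B : measurableType d) (R : realType)
  (nu : probability B R) (Lam : groupType) (act : Lam -> {mfun B >-> B}).
Hypothesis act_action : is_action act.
Hypothesis nu_qinv : quasi_invariant nu act.

(* D g is the density of g_* nu: the inverse in the cocycle c(g^-1, -) cancels
   the one in its definition. *)
Let D (g : Lam) : B -> \bar R :=
  Radon_Nikodym (charge_of_finite_measure (distribution nu (act g))) nu.

(** Quasi-invariance speaks of direct images while a pushforward is computed
    with preimages; invertibility of the action reconciles them. *)
Lemma act_preimageV g (C : set B) : act g @^-1` C = act g^-1%g @` C.
Proof.
have [a1 aM] := act_action.
apply/seteqP; split=> [b Cb|_ [b Cb <-]] /=.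
  by exists (act g b) => //; rewrite -aM mulVg a1.
by rewrite -aM mulgV a1.
Qed.

Lemma distribution_dominated g : distribution nu (act g) `<< nu.
Proof.
apply/null_content_dominatesP => C mC C0.
by rewrite /distribution /pushforward act_preimageV; exact: nu_qinv.
Qed.
Local Notation dom := distribution_dominated.

Let D_ge0 g : {ae nu, forall b, (0 <= D g b)%E}.
Proof.
have := ae_eq_Radon_Nikodym_SigmaFinite (dom g) measurableT.
apply: filterS => b /(_ I); rewrite /D => <-.
exact: Radon_Nikodym_SigmaFinite.f_ge0 (dom g) b.
Qed.

Let D_int g : nu.-integrable setT (D g).
Proof. by apply: Radon_Nikodym_integrable; exact: dom. Qed.

Let mD g : measurable_fun setT (D g).
Proof. by have /integrableP[] := D_int g. Qed.

Let D_fin g b : D g b \is a fin_num.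
Proof. by apply: Radon_Nikodym_fin_num; exact: dom. Qed.

Let D_integral g C : measurable C ->
  (\int[nu]_(b in C) D g b = nu (act g @^-1` C))%E.
Proof.
move=> mC; rewrite [RHS](_ : _ = charge_of_finite_measure
  (distribution nu (act g)) C)//.
by rewrite [RHS](@Radon_Nikodym_integral _ _ _ _ nu)//; exact: dom.
Qed.

(* Chain rule for (gh)_* nu = g_* (h_* nu). Both sides are compared through
   their integrals over an arbitrary measurable set C. *)
Let D_cocycle g h :
  {ae nu, forall b, D (g * h)%g b = (D h (act g^-1%g b) * D g b)%E}.
Proof.
have [a1 aM] := act_action.
have mDV : measurable_fun setT (fun b => D h (act g^-1%g b)).
  exact: (measurableT_comp (mD h) (measurable_funPT (act g^-1%g))).
suff : ae_eq nu setT (D (g * h)%g)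
    (fun b => D h (act g^-1%g b) * D g b)%E.
  by apply: filterS => b /(_ I).
apply: integral_ae_eq => //; first exact: emeasurable_funM.
move=> C _ mC.
have mgC : measurable (act g @^-1` C).
  by rewrite -[X in measurable X]setTI; exact: measurable_funPT.
have compE : (fun b => D h (act g^-1%g b)) \o act g = D h.
  by apply/funext => b /=; rewrite -aM mulVg a1.
have iD : nu.-integrable (act g @^-1` C)
    ((fun b => D h (act g^-1%g b)) \o act g).
  by rewrite compE; apply: (integrableS measurableT).
rewrite D_integral//.
rewrite (Radon_Nikodym_change_of_variables (dom g) mC); last first.
  exact: integrable_pushforward.
rewrite [RHS](integral_pushforward (measurable_funPT (act g)) mDV iD mC) compE.
rewrite D_integral//.
by congr (nu _); apply/seteqP; split=> b /=; rewrite aM.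
Qed.

(** The function pi(g)1. Since Num.sqrt vanishes on negative numbers, it is
    nonnegative at every point, although the density is so only almost
    everywhere. *)
Definition koopman_weight (g : Lam) (b : B) : R :=
  Num.sqrt (rn_cocycle nu act g^-1%g b).
Local Notation s := koopman_weight.

Let sE g b : s g b = Num.sqrt (fine (D g b)).
Proof. by rewrite /s /rn_cocycle invgK. Qed.

Lemma koopman_weight_ge0 g b : 0 <= s g b.
Proof. exact: sqrtr_ge0. Qed.

Lemma measurable_koopman_weight g : measurable_fun setT (s g).
Proof.
rewrite (_ : s g = Num.sqrt \o (fine \o D g)); last exact/funext/sE.
apply: (measurableT_comp (@measurable_sqrtr R)).
by apply: measurableT_comp => //; exact: mD.
Qed.

(** Unitarity of pi on the constant function: pi(g)1 has norm 1, because
    g_* nu is a probability. *)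
Lemma integral_koopman_weight_sqr g :
  (\int[nu]_b (s g b ^+ 2)%:E = 1)%E.
Proof.
rewrite (ae_eq_integral (D g)) //; last first.
- have := D_ge0 g; apply: filterS => b D0 _.
  by rewrite sE sqr_sqrtr ?fine_ge0// fineK// D_fin.
- apply/measurable_EFinP; apply: measurable_funX.
  exact: measurable_koopman_weight.
by rewrite D_integral// preimage_setT probability_setT.
Qed.

(** This is pi(gh)1 = pi(g)pi(h)1, the only instance of multiplicativity of pi
    that the comparison with the regular representation uses. *)
Lemma koopman_weight_cocycle g h :
  {ae nu, forall b, s (g * h)%g b = s g b * s h (act g^-1%g b)}.
Proof.
move: (D_cocycle g h) (D_ge0 g); apply: filterS2 => b.
rewrite !sE => -> g0.
by rewrite fineM// mulrC sqrtrM// fine_ge0.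
Qed.

(** If Xi(g) were 0, the nonnegative function pi(g)1 would vanish almost
    everywhere, against its norm being 1. The finiteness of the integral must
    be checked first, as the real-valued integral is 0 when it diverges. *)
Lemma harish_chandra_gt0 g : 0 < harish_chandra nu act g.
Proof.
have s0 b : (0 <= (s g b)%:E)%E by rewrite lee_fin koopman_weight_ge0.
have ms : measurable_fun setT (s g) by exact: measurable_koopman_weight.
have ms2 : measurable_fun setT (fun b => s g b ^+ 2) by exact: measurable_funX.
have fin : ((\int[nu]_b (s g b)%:E) < +oo)%E.
  (* x <= 1 + x ^ 2, and the square has integral 1 *)
  apply: (@le_lt_trans _ _ (\int[nu]_b (1%:E + (s g b ^+ 2)%:E)))%E.
    apply: ge0_le_integral => //.
    - exact/measurable_EFinP.
    - apply: emeasurable_funD => //; exact/measurable_EFinP.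
    - move=> b _; rewrite -EFinD lee_fin.
      have /orP[h|h] := le_total (s g b) 1.
        by rewrite (le_trans h)// lerDl sqr_ge0.
      apply: (@le_trans _ _ (s g b ^+ 2)); last by rewrite lerDr ler01.
      by rewrite expr2 ler_peMl// koopman_weight_ge0.
  rewrite ge0_integralD//; last 2 first.
  - by move=> b _; rewrite lee_fin sqr_ge0.
  - exact/measurable_EFinP.
  rewrite integral_cst// mul1e.
  rewrite [X in (X + _)%E](_ : _ = 1%E); last exact: probability_setT.
  by rewrite integral_koopman_weight_sqr -EFinD ltry.
rewrite /harish_chandra /Rintegral fine_gt0// fin andbT lt0e.
rewrite integral_ge0 ?andbT; last by move=> b _; exact: s0.
apply/eqP => I0.
have : (\int[nu]_b `|(s g b)%:E| = 0)%E.
  by rewrite -[RHS]I0; apply: eq_integral => b _; rewrite gee0_abs.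
have/measurable_EFinP ms' := ms.
move=> /(ae_eq_integral_abs nu measurableT ms') s_ae0.
have := integral_koopman_weight_sqr g.
rewrite (ae_eq_integral (cst 0%E)) //.
- by rewrite integral0 => /eqP; rewrite eqe eq_sym oner_eq0.
- exact/measurable_EFinP.
- by move: s_ae0; apply: filterS => b /(_ I)[->] _; rewrite expr0n.
Qed.

End KoopmanWeight.

(** * Domination of the regular representation by pi *)

Section Majorization.
Context (d : measure_display) (B : measurableType d) (R : realType)
  (nu : probability B R) (Lam : groupType) (act : Lam -> {mfun B >-> B}).
Hypothesis act_action : is_action act.
Hypothesis nu_qinv : quasi_invariant nu act.
Local Notation s := (koopman_weight nu act).
Let s_ge0 g b : 0 <= s g b. Proof. exact: koopman_weight_ge0. Qed.
Let ms g : measurable_fun setT (s g).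
Proof. exact: measurable_koopman_weight. Qed.
Let ms_act g h : measurable_fun setT (fun b => s g (act h b)).
Proof. exact: (measurableT_comp (ms g) (measurable_funPT (act h))). Qed.

(** Fell absorption on coefficients: the inner product of pi(h)(pi(h^-1 g)1)
    with pi(g)1 is 1, since both vectors equal pi(g)1. *)
Lemma koopman_weight_pairing h g :
  (\int[nu]_b (s h b * s (h^-1 * g)%g (act h^-1%g b) * s g b)%:E = 1)%E.
Proof.
rewrite -(integral_koopman_weight_sqr act_action nu_qinv g).
apply: ae_eq_integral => //.
- apply/measurable_EFinP; apply: measurable_funM => //.
  by apply: measurable_funM => //; exact: ms_act.
- by apply/measurable_EFinP; exact: measurable_funX.
- have := koopman_weight_cocycle act_action nu_qinv h (h^-1 * g)%g.
  by apply: filterS => b; rewrite mulVKg expr2 => <- _.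
Qed.

(** The ell^2 norm over k of the family u(k) (pi(k)1)(b), the point b of B being
    fixed. *)
Definition fibre_norm (u : Lam -> R) (E : seq Lam) (b : B) : R :=
  Num.sqrt (\sum_(k <- E) (u k * s k b) ^+ 2).

Lemma fibre_norm_ge0 u E b : 0 <= fibre_norm u E b.
Proof. exact: sqrtr_ge0. Qed.

Lemma measurable_fibre_norm u E : measurable_fun setT (fibre_norm u E).
Proof.
apply: (measurableT_comp (@measurable_sqrtr R)).
apply: measurable_sum => k; apply: measurable_funX.
exact: measurable_funM.
Qed.

(** The passage from u to its fibre norm is isometric, by Fubini and because
    every pi(k)1 has norm 1. *)
Lemma Lnorm_fibre_norm u E :
  'N[nu]_2%:E[EFin \o fibre_norm u E]%E
    = (Num.sqrt (\sum_(k <- E) u k ^+ 2))%:E.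
Proof.
have S0 b : 0 <= \sum_(k <- E) (u k * s k b) ^+ 2.
  by apply: sumr_ge0 => k _; exact: sqr_ge0.
rewrite unlock /=.
under eq_integral => b _ do
  rewrite ger0_norm ?fibre_norm_ge0// powR_mulrn ?fibre_norm_ge0//
          sqr_sqrtr// -sumEFin.
rewrite ge0_integral_sum//; last 2 first.
- move=> k; apply/measurable_EFinP; apply: measurable_funX.
  exact: measurable_funM.
- by move=> k b _; rewrite lee_fin sqr_ge0.
rewrite (eq_bigr (fun k => (u k ^+ 2)%:E)); last first.
  move=> k _; under eq_integral => b _ do rewrite exprMn EFinM.
  rewrite ge0_integralZl_EFin ?sqr_ge0//; last 2 first.
  - by move=> b _; rewrite lee_fin sqr_ge0.
  - by apply/measurable_EFinP; exact: measurable_funX.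
  by rewrite (integral_koopman_weight_sqr act_action nu_qinv) mule1.
rewrite sumEFin poweR_EFin powR12_sqrt//.
by apply: sumr_ge0 => k _; exact: sqr_ge0.
Qed.

(** The left side is a coefficient of the regular representation at the
    indicator function of C, the right side the corresponding coefficient of pi
    between the fibre norms of u and eta. Inserting [koopman_weight_pairing] in
    each term makes the left side an integral over B, whose integrand is bounded
    pointwise: for fixed b and h, Cauchy-Schwarz in g. Positivity of the vectors
    pi(g)1 is what allows this bound under the integral. Only the values of u on
    E matter, which keeps every sum finite. *)
Lemma herz_majorization (C A E : seq Lam) (u eta : Lam -> R) :
  uniq A -> uniq E ->
  (forall h g, h \in C -> g \in A -> (h^-1 * g)%g \in E) ->
  (forall g, 0 <= u g) -> (forall g, 0 <= eta g) ->
  ((\sum_(h <- C) \sum_(g <- A) u (h^-1 * g)%g * eta g)%:E <=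
   \int[nu]_b ((\sum_(h <- C) s h b * fibre_norm u E (act h^-1%g b)) *
               fibre_norm eta A b)%:E)%E.
Proof.
move=> uA uE CAE u0 eta0.
pose F h g b := u (h^-1 * g)%g * eta g *
  (s h b * s (h^-1 * g)%g (act h^-1%g b) * s g b).
have F0 h g b : 0 <= F h g b by rewrite !mulr_ge0.
have mF h g : measurable_fun setT (F h g).
  apply: measurable_funM => //; apply: measurable_funM => //.
  by apply: measurable_funM => //; exact: ms_act.
have mN v D h : measurable_fun setT (fun b => fibre_norm v D (act h b)).
  exact: (measurableT_comp (measurable_fibre_norm v D) (measurable_funPT (act h))).
have FE h g : (\int[nu]_b (F h g b)%:E = (u (h^-1 * g)%g * eta g)%:E)%E.
  under eq_integral => b _ do rewrite EFinM.
  rewrite ge0_integralZl_EFin ?mulr_ge0//; last 2 first.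
  - by move=> b _; rewrite lee_fin !mulr_ge0.
  - apply/measurable_EFinP; apply: measurable_funM => //.
    by apply: measurable_funM => //; exact: ms_act.
  by rewrite koopman_weight_pairing mule1.
rewrite [leLHS](_ : _ =
    \int[nu]_b (\sum_(h <- C) \sum_(g <- A) F h g b)%:E)%E; last first.
  under eq_integral => b _ do rewrite -sumEFin.
  rewrite ge0_integral_sum//; last 2 first.
  - by move=> h; apply/measurable_EFinP; apply: measurable_sum.
  - by move=> h b _; rewrite lee_fin sumr_ge0.
  rewrite -sumEFin; apply: eq_bigr => h _.
  under eq_integral => b _ do rewrite -sumEFin.
  rewrite ge0_integral_sum//; last 2 first.
  - by move=> g; apply/measurable_EFinP.
  - by move=> g b _; rewrite lee_fin.
  by rewrite -sumEFin; apply: eq_bigr => g _; rewrite FE.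
apply: ge0_le_integral => //.
- by move=> b _; rewrite lee_fin; apply: sumr_ge0 => h _; apply: sumr_ge0.
- by apply/measurable_EFinP; do 2 apply: measurable_sum => ?.
- apply/measurable_EFinP; apply: measurable_funM; last exact: measurable_fibre_norm.
  by apply: measurable_sum => h; exact: measurable_funM.
move=> b _; rewrite lee_fin mulr_suml.
rewrite big_seq [leRHS]big_seq; apply: ler_sum => h hC.
rewrite (eq_bigr (fun g => s h b *
    ((u (h^-1 * g)%g * s (h^-1 * g)%g (act h^-1%g b)) * (eta g * s g b))));
  last by move=> g _; rewrite /F; ring.
rewrite -mulr_sumr -mulrA ler_wpM2l//.
apply: le_trans (cauchy_schwarz_sum _ _ _) _.
rewrite ler_wpM2r ?sqrtr_ge0// ler_wsqrtr//.
pose G k := (u k * s k (act h^-1%g b)) ^+ 2.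
(* g |-> h^-1 g maps A injectively into E *)
rewrite -(big_map (fun g => (h^-1 * g)%g) xpredT G).
apply: sum_subseq_le => //.
- by rewrite map_inj_uniq//; exact: mulgI.
- by move=> _ /mapP[g gA ->]; exact: CAE.
- by move=> k; exact: sqr_ge0.
Qed.

End Majorization.

(** * Convolution by the indicator of an annulus *)

Section AnnulusBound.
Context (d : measure_display) (B : measurableType d) (R : realType)
  (nu : probability B R) (Lam : groupType) (act : Lam -> {mfun B >-> B})
  (L : Lam -> R).
Hypothesis act_action : is_action act.
Hypothesis nu_qinv : quasi_invariant nu act.
Local Notation s := (koopman_weight nu act).
Local Notation Xi := (harish_chandra nu act).

Lemma norm_L2_real (phi : B -> R) : (forall b, 0 <= phi b) ->
  norm_L2 nu (fun b => (phi b)%:C%C) = ('N[nu]_2%:E[EFin \o phi])%E.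
Proof. by move=> phi0; apply: eq_Lnorm => b; rewrite modulus_real. Qed.

(* the annulus average as an operator on real functions *)
Let avg n (phi : B -> R) b := (card_annulus L n)%:R^-1 *
  \sum_(g <- fset_set (annulus L n)) s g b * phi (act g^-1%g b) / Xi g.

Lemma annulus_average_real n (phi : B -> R) : finite_set (annulus L n) ->
  annulus_average nu act L n (fun b => (phi b)%:C%C)
    = fun b => (avg n phi b)%:C%C.
Proof.
move=> fin; apply/funext => b.
rewrite /annulus_average /avg fsbig_finite//.
rewrite rmorphM fmorphV rmorph_nat rmorph_sum; congr (_ * _).
by apply: eq_bigr => g _; rewrite fmorph_div rmorphM.
Qed.

(** The norm bound for convolution by the indicator of an annulus, stated for
    the pairing of u with a finitely supported eta so that no operator on ell^2
    has to be formed. The majorization reduces it to pi; there Xi is traded for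
    its bound, at the cost of a factor p sqrt |C_n|, and what remains is the
    average of the hypothesis, tested on Phi and paired with Psi by Hoelder.
    Normalizing u to norm at most 1 puts Phi in the unit ball over which the
    operator norm is a supremum. *)
Lemma annulus_convolution_bound n (M p : R) (A : seq Lam) (u eta : Lam -> R) :
  finite_set (annulus L n) -> annulus L n !=set0 ->
  (sup (Xi @` annulus L n) <= p / Num.sqrt (card_annulus L n)%:R) ->
  (op_norm (L2 nu) (norm_L2 nu) (annulus_average nu act L n) <= M%:E)%E ->
  uniq A -> (forall g, 0 <= u g) -> (forall g, 0 <= eta g) ->
  (forall E, uniq E -> \sum_(k <- E) u k ^+ 2 <= 1) ->
  \sum_(h <- fset_set (annulus L n)) \sum_(g <- A) u (h^-1 * g)%g * eta g
    <= p * M * Num.sqrt (card_annulus L n)%:R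
         * Num.sqrt (\sum_(g <- A) eta g ^+ 2).
Proof.
move=> fin ne supXi avgM uA u0 eta0 u1.
set C := fset_set (annulus L n); set c := card_annulus L n in supXi *.
have c0 : 0 < (c%:R : R).
  rewrite ltr0n cardfs_gt0; apply/fset0Pn.
  by have [g Cg] := ne; exists g; rewrite in_fset_set// inE.
have Xi0 g : 0 < Xi g by exact: harish_chandra_gt0.
have hC h : h \in C -> annulus L n h by rewrite in_fset_set// inE.
have Xi_le h : h \in C -> Xi h <= p / Num.sqrt c%:R.
  move=> /hC Ch; apply: le_trans supXi; apply: ub_le_sup; last by exists h.
  (* a finite set of nonnegative reals is bounded by its sum *)
  exists (\sum_(g <- C) Xi g) => _ [g Cg <-].
  have gC : g \in C by rewrite in_fset_set// inE.
  have := @sum_subseq_le R _ [:: g] C Xi; rewrite big_seq1.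
  apply => //; first exact: fset_uniq.
  - by move=> k; rewrite inE => /eqP ->.
  - by move=> k; exact: ltW.
pose E := undup [seq (h^-1 * g)%g | h <- C, g <- A].
pose Phi := fibre_norm nu act u E.
pose Psi := fibre_norm nu act eta A.
have Phi0 b : 0 <= Phi b by exact: fibre_norm_ge0.
have Psi0 b : 0 <= Psi b by exact: fibre_norm_ge0.
have mPhi : measurable_fun setT Phi by exact: measurable_fibre_norm.
have mPsi : measurable_fun setT Psi by exact: measurable_fibre_norm.
have ms g : measurable_fun setT (s g) by exact: measurable_koopman_weight.
have mT h : measurable_fun setT (fun b => s h b * Phi (act h^-1%g b)).
  apply: measurable_funM => //.
  exact: (measurableT_comp mPhi (measurable_funPT (act h^-1%g))).
have T0 h b : 0 <= s h b * Phi (act h^-1%g b).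
  by rewrite mulr_ge0// koopman_weight_ge0.
have avg0 b : 0 <= avg n Phi b.
  rewrite mulr_ge0// sumr_ge0// => g _.
  by rewrite divr_ge0// ltW.
have mavg : measurable_fun setT (avg n Phi).
  apply: measurable_funM => //; apply: measurable_sum => g.
  by apply: measurable_funM.
have normPhi : (norm_L2 nu (fun b => (Phi b)%:C%C) <= 1)%E.
  rewrite norm_L2_real// Lnorm_fibre_norm// lee_fin -sqrtr1 ler_wsqrtr//.
  by apply: u1; exact: undup_uniq.
have avg_le : ('N[nu]_2%:E[EFin \o avg n Phi] <= M%:E)%E.
  rewrite -norm_L2_real// -annulus_average_real//.
  apply: le_trans avgM; apply: ereal_sup_ubound.
  exists (fun b => (Phi b)%:C%C) => //; split => //.
  split => //.
  by apply: le_lt_trans normPhi _; rewrite ltry.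
(* p inherits its sign from Xi > 0 *)
have p0 : 0 <= p / Num.sqrt c%:R.
  have [g Cg] := ne; apply: le_trans (ltW (Xi0 g)) (Xi_le _ _).
  by rewrite in_fset_set// inE.
have sc0 : 0 < Num.sqrt (c%:R : R) by rewrite sqrtr_gt0.
have K0 : 0 <= p * Num.sqrt c%:R.
  by rewrite mulr_ge0 ?sqrtr_ge0//; move: p0; rewrite pmulr_lge0// invr_gt0.
have sum_le b : \sum_(h <- C) s h b * Phi (act h^-1%g b)
    <= p * Num.sqrt c%:R * avg n Phi b.
  rewrite [leRHS](_ : _ = \sum_(h <- C) p / Num.sqrt c%:R *
      (s h b * Phi (act h^-1%g b) / Xi h)); last first.
    rewrite /avg -mulr_sumr mulrA; congr (_ * _).
    rewrite (_ : (card_annulus L n)%:R^-1 =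
        (Num.sqrt c%:R)^-1 * (Num.sqrt c%:R)^-1).
      by rewrite -mulrA mulVKf// gt_eqF.
    by rewrite -invfM -expr2 sqr_sqrtr// ltW.
  rewrite big_seq [leRHS]big_seq; apply: ler_sum => h hh.
  rewrite mulrCA ler_peMr// ler_pdivlMr ?mul1r//; exact: Xi_le.
rewrite -lee_fin.
apply: (le_trans (herz_majorization act_action nu_qinv (E := E) _ _ _ _ _)) => //.
- exact: undup_uniq.
- by move=> h g hh gA; rewrite mem_undup; apply: allpairs_f.
apply: (@le_trans _ _
    (\int[nu]_b ((p * Num.sqrt c%:R)%:E * (avg n Phi b * Psi b)%:E)))%E.
  apply: ge0_le_integral => //.
  - by move=> b _; rewrite lee_fin mulr_ge0// sumr_ge0.
  - apply/measurable_EFinP; apply: measurable_funM => //.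
    exact: measurable_sum.
  - apply: emeasurable_funM => //.
    by apply/measurable_EFinP; apply: measurable_funM.
  - by move=> b _; rewrite -EFinM lee_fin mulrA ler_wpM2r.
rewrite ge0_integralZl_EFin//; last 2 first.
- by move=> b _; rewrite lee_fin mulr_ge0.
- by apply/measurable_EFinP; apply: measurable_funM.
rewrite [leRHS](_ : _ = (p * Num.sqrt c%:R)%:E *
    (M%:E * (Num.sqrt (\sum_(g <- A) eta g ^+ 2))%:E))%E; last first.
  by rewrite -!EFinM; congr EFin; ring.
rewrite lee_wpmul2l ?lee_fin//.
have half : 2^-1 + 2^-1 = 1 :> R by field.
have := @hoelder _ _ _ nu _ _ 2 2 mavg mPsi (ltr0n _ 2) (ltr0n _ 2) half.
rewrite Lnorm1 Lnorm_fibre_norm//.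
rewrite (_ : \int[nu]_b _ = \int[nu]_b (avg n Phi b * Psi b)%:E)%E; last first.
  by apply: eq_integral => b _; rewrite gee0_abs// lee_fin mulr_ge0.
move=> /le_trans; apply.
by rewrite lee_wpmul2r// lee_fin sqrtr_ge0.
Qed.

End AnnulusBound.

(** * The norm of ell^2 through finite sums *)

Section Ell2.
Context (R : realType) (Lam : groupType).
Implicit Types (xi : Lam -> R[i]) (K : R).

Lemma norm_ell2E xi : norm_ell2 xi =
  sqrte (\esum_(g in [set: Lam]) (modulus (xi g) ^+ 2)%:E).
Proof.
rewrite /norm_ell2 poweR12_sqrt//.
by apply: esum_ge0 => g _; rewrite lee_fin sqr_ge0.
Qed.

Lemma le_norm_ell2 xi (A : seq Lam) : uniq A ->
  ((Num.sqrt (\sum_(g <- A) modulus (xi g) ^+ 2))%:E <= norm_ell2 xi)%E.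
Proof.
move=> uA; rewrite norm_ell2E.
rewrite -[leLHS]/(sqrte (\sum_(g <- A) modulus (xi g) ^+ 2)%:E).
rewrite lee_sqrt; last by apply: esum_ge0 => g _; rewrite lee_fin sqr_ge0.
apply: esum_ge; exists [set` A]; first by split => //; exact: finite_seq.
by rewrite -fsbig_seq// sumEFin.
Qed.

Lemma norm_ell2_le xi K : 0 <= K ->
  (forall A : seq Lam, uniq A -> \sum_(g <- A) modulus (xi g) ^+ 2 <= K ^+ 2) ->
  (norm_ell2 xi <= K%:E)%E.
Proof.
move=> K0 xiK; rewrite norm_ell2E.
rewrite -[K in leRHS]ger0_norm// -sqrtr_sqr -[leRHS]/(sqrte (K ^+ 2)%:E).
rewrite lee_sqrt ?lee_fin ?sqr_ge0//.
apply: ge_ereal_sup => _ [A [finA _] <-].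
by rewrite fsbig_finite// sumEFin lee_fin; apply: xiK; exact: fset_uniq.
Qed.

End Ell2.

(** * A monotone polynomial majorant *)

Section AbsolutePolynomial.
Context (R : realDomainType).

(** Its coefficients being nonnegative, this polynomial is monotone on the
    nonnegative reals, so its value at L(f) bounds |P(n)| for all n <= L(f) at
    once. *)
Definition abs_poly (P : {poly R}) : {poly R} := \poly_(i < size P) `|P`_i|.

Lemma norm_horner_le_abs_poly P x y : 0 <= x -> x <= y ->
  `|P.[x]| <= (abs_poly P).[y].
Proof.
move=> x0 xy; rewrite horner_coef horner_poly.
apply: le_trans (ler_norm_sum _ _ _) _; apply: ler_sum => i _.
by rewrite normrM normrX (ger0_norm x0) ler_wpM2l// lerXn2r// nnegrE (le_trans x0).
Qed.

End AbsolutePolynomial.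

(** * Radial functions *)

Theorem theorem1 (R : realType) (Lam : groupType) (L : Lam -> R)
  (L_length : length_function L)
  (L_proper : proper_length L)
  (L_int : forall g, L g \is a Num.int)
  (d : measure_display) (B : measurableType d) (nu : probability B R)
  (act : Lam -> {mfun B >-> B})
  (act_action : is_action act)
  (nu_qinv : quasi_invariant nu act)
  (M : R) (P : {poly R})
  (Xi_bound : forall n : nat, annulus L n !=set0 ->
     sup (harish_chandra nu act @` annulus L n)
       <= P.[n%:R] / Num.sqrt (card_annulus L n)%:R)
  (average_bound : forall n : nat, annulus L n !=set0 ->
     (op_norm (L2 nu) (norm_L2 nu) (annulus_average nu act L n) <= M%:E)%E) :
  RRD L.
Proof.
have [L_ge0 _ _ _] := L_length.
have annulus_finite n : finite_set (annulus L n).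
  apply: sub_finite_set (L_proper n.+1%:R (ler0n _ _)) => g /andP[_ /ltW].
  exact.
exists (`|M|%:P * (('X + 1) * abs_poly P)) => f f0 f_radial.
set ell := length_of L f; set S := finsupp f.
have ell_ge h : h \in S -> L h <= ell.
  by move=> hS; rewrite /ell /length_of le_bigmax_seq.
have ell0 : 0 <= ell by exact: bigmax_ge_id.
pose N := Num.truncn ell.
have deg_lt h : h \in S -> (Num.truncn (L h) < N.+1)%N.
  by move=> /ell_ge; rewrite ltnS; exact: le_truncn.
pose nf := Num.sqrt (\sum_(h <- S) modulus (f h) ^+ 2).
have nf_le : (nf%:E <= norm_ell2 f)%E by apply: le_norm_ell2; exact: fset_uniq.
have absP0 : 0 <= (abs_poly P).[ell].
  exact: le_trans (normr_ge0 _) (norm_horner_le_abs_poly P (lexx _) ell0).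
have Q0 : 0 <= (`|M|%:P * (('X + 1) * abs_poly P)).[ell].
  by rewrite !hornerE !mulr_ge0// ?addr_ge0.
set Q := _.[ell] in Q0 *.
apply: ge_ereal_sup => _ [xi [_ xi1] <-].
apply: (@le_trans _ _ (Q%:E * nf%:E)%E); last by rewrite lee_wpmul2l.
rewrite -EFinM; apply: norm_ell2_le; first by rewrite mulr_ge0// sqrtr_ge0.
move=> A uA.
pose u g := modulus (xi g).
have u0 g : 0 <= u g by exact: modulus_ge0.
have u_le1 E : uniq E -> \sum_(k <- E) u k ^+ 2 <= 1.
  move=> uE; have := le_trans (le_norm_ell2 xi uE) xi1.
  by rewrite lee_fin -[X in _ <= X]sqrtr1 ler_sqrt.
(* By positivity |f * xi| <= |f| * |xi| = v, and it suffices to bound the sum s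
   of v ^ 2 over a finite set A. Pairing |f| * |xi| with v itself over A gives
   s <= K sqrt s, whence sqrt s <= K. *)
pose v g := \sum_(h <- S) modulus (f h) * u (h^-1 * g)%g.
have v0 g : 0 <= v g.
  by apply: sumr_ge0 => h _; rewrite mulr_ge0// modulus_ge0.
have conv_le g : modulus (convolution f xi g) <= v g.
  apply: le_trans (modulus_sum_le _ _) _.
  by apply: ler_sum => h _; rewrite ComplexField.Normc.normcM.
set s := \sum_(g <- A) v g ^+ 2.
have s0 : 0 <= s by apply: sumr_ge0 => g _; exact: sqr_ge0.
apply: (@le_trans _ _ s).
  by apply: ler_sum => g _; rewrite lerXn2r// nnegrE// modulus_ge0.
pose W h := \sum_(g <- A) u (h^-1 * g)%g * v g.
have sE : s = \sum_(h <- S) modulus (f h) * W h.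
  rewrite /s; under eq_bigr => g _ do rewrite expr2 mulr_suml.
  rewrite exchange_big; apply: eq_bigr => h _.
  by rewrite mulr_sumr; apply: eq_bigr => g _; rewrite mulrA.
have c0 : 0 <= (abs_poly P).[ell] * `|M| * nf * Num.sqrt s.
  by rewrite !mulr_ge0 ?sqrtr_ge0 ?normr_ge0.
(* Contribution to s of the annulus of radius n. *)
have sphere n : (n < N.+1)%N ->
    \sum_(h <- S | Num.truncn (L h) == n) modulus (f h) * W h
      <= (abs_poly P).[ell] * `|M| * nf * Num.sqrt s.
  (* An annulus that meets the support of f lies inside it, and f is constant
     there: all its points have length exactly n, L being integer-valued. *)
  move=> nN; have [|no_h] := boolP (has (fun h => Num.truncn (L h) == n) S);
    last by rewrite big_hasC.
  move=> /hasP[h0 h0S /eqP h0n].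
  have in_annulus h : annulus L n h <-> Num.truncn (L h) = n.
    by rewrite (rwP eqP) truncn_eq.
  have f_const h : Num.truncn (L h) = n -> f h = f h0.
    move=> hn; apply: f_radial.
    have Lnat g : L g \is a Num.nat by rewrite natrEint L_int L_ge0.
    by rewrite -(truncnK (Lnat h)) -(truncnK (Lnat h0)) hn h0n.
  have ne : annulus L n !=set0 by exists h0; apply/in_annulus.
  set C := fset_set (annulus L n).
  have inC h : (h \in C) = (Num.truncn (L h) == n).
    rewrite in_fset_set//; apply/idP/eqP; first by rewrite inE => /in_annulus.
    by move=> /in_annulus; rewrite inE.
  have CS h : h \in C -> h \in S.
    by rewrite inC => /eqP/f_const hE; rewrite mem_finsupp hE -mem_finsupp.
  have perm : perm_eq [seq h <- S | Num.truncn (L h) == n] C.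
    apply: uniq_perm; rewrite ?filter_uniq ?fset_uniq// => h.
    rewrite mem_filter -inC; apply/andP/idP => [[]//|hC]; split => //.
    exact: CS.
  set a := modulus (f h0).
  have fC h : h \in C -> modulus (f h) = a by rewrite inC => /eqP/f_const ->.
  rewrite -big_filter (perm_big _ perm).
  rewrite big_seq; under eq_bigr => h hC do rewrite (fC h hC).
  rewrite -big_seq -mulr_sumr.
  (* the ell^2 norm of the restriction of f to the annulus *)
  have a_le : a * Num.sqrt (card_annulus L n)%:R <= nf.
    rewrite -[a]ger0_norm ?modulus_ge0// -sqrtr_sqr -sqrtrM ?sqr_ge0//.
    apply: ler_wsqrtr; rewrite mulr_natr.
    apply: le_trans (sum_subseq_le (fset_uniq C) (fset_uniq S) CS _).
      rewrite big_seq; under eq_bigr => h hC do rewrite (fC h hC).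
      by rewrite -big_seq big_const_seq count_predT iter_addr_0.
    by move=> h; exact: sqr_ge0.
  have := annulus_convolution_bound act_action nu_qinv (annulus_finite n) ne
    (Xi_bound n ne) (average_bound n ne) uA u0 v0 u_le1.
  move=> /(ler_wpM2l (modulus_ge0 (f h0)))/le_trans; apply.
  rewrite -/a -/s.
  have PM : P.[n%:R] * M <= (abs_poly P).[ell] * `|M|.
    apply: le_trans (ler_norm _) _; rewrite normrM ler_wpM2r//.
    apply: norm_horner_le_abs_poly; rewrite ?ler0n//.
    by apply: le_trans (ell_ge _ h0S); rewrite -h0n truncn_le.
  rewrite mulrA ler_wpM2r ?sqrtr_ge0// mulrCA.
  have a0 : 0 <= a * Num.sqrt (card_annulus L n)%:R.
    by rewrite mulr_ge0 ?sqrtr_ge0// modulus_ge0.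
  apply: (@le_trans _ _ ((abs_poly P).[ell] * `|M| *
      (a * Num.sqrt (card_annulus L n)%:R))); first by rewrite ler_wpM2r.
  by rewrite ler_wpM2l// mulr_ge0.
have s_le : s <= (Q * nf) * Num.sqrt s.
  rewrite [leLHS]sE.
  rewrite (_ : \sum_(h <- S) _ = \sum_(n < N.+1)
    \sum_(h <- S | Num.truncn (L h) == n) modulus (f h) * W h); last first.
    under [RHS]eq_bigr => n _ do rewrite big_mkcond.
    rewrite exchange_big big_seq [RHS]big_seq.
    apply: eq_bigr => h hS; rewrite -big_mkcond.
    by rewrite (big_pred1 (Ordinal (deg_lt h hS)))// => n; rewrite eq_sym.
  apply: (@le_trans _ _
      (\sum_(n < N.+1) (abs_poly P).[ell] * `|M| * nf * Num.sqrt s)).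
    by apply: ler_sum => n _; exact: sphere.
  rewrite sumr_const card_ord -mulr_natl.
  (* N <= L(f) bounds the number N + 1 of annuli *)
  apply: (@le_trans _ _ ((ell + 1) *
      ((abs_poly P).[ell] * `|M| * nf * Num.sqrt s))).
    by rewrite ler_wpM2r// -natr1 lerD2r truncn_le.
  rewrite le_eqVlt; apply/orP; left; apply/eqP.
  by rewrite /Q !hornerM hornerD hornerX !hornerC; ring.
have : Num.sqrt s <= Q * nf.
  have [->|sq0] := eqVneq (Num.sqrt s) 0; first by rewrite mulr_ge0 ?sqrtr_ge0.
  have sp : 0 < Num.sqrt s by rewrite lt0r sq0 sqrtr_ge0.
  by rewrite -(ler_pM2r sp) -expr2 sqr_sqrtr.
move=> h; rewrite -(sqr_sqrtr s0) lerXn2r// nnegrE ?sqrtr_ge0//.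
by rewrite mulr_ge0// sqrtr_ge0.
Qed.
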